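(* Let $(X,d)$ be a complete CAT(0) space and let $F:X\to(-\infty,\infty]$ be proper, convex and lower semicontinuous. Then for every $\mu>0$, its resolvent $J_\mu:X\to X$ is a firmly nonexpansive mapping.
   Context: A geodesic in a metric space $(X,d)$ is a map $\gamma:[a,b]\to X$ with $d(\gamma(s),\gamma(t))=|s-t|$ for all $s,t\in[a,b]$; $X$ is a geodesic space if any two distinct points are the endpoints $\gamma(a),\gamma(b)$ of some geodesic. A CAT(0) space is a geodesic space such that for all $x,y,z\in X$ and all $m\in X$ with $d(x,m)=d(y,m)=\frac12d(x,y)$ one has $d(z,m)^2\le\frac12d(z,x)^2+\frac12d(z,y)^2-\frac14d(x,y)^2$. In a CAT(0) space, for $x,y\in X$ and $\lambda\in[0,1]$, $(1-\lambda)x\oplus\lambda y$ denotes the unique point $z$ with $d(x,z)=\lambda d(x,y)$ and $d(y,z)=(1-\lambda)d(x,y)$. $F:X\to(-\infty,\infty]$ is convex if $F\circ\gamma$ is convex for every geodesic $\gamma$ in $X$, and proper if $F(x)<\infty$ for some $x\in X$. For $F$ proper, convex and lower semicontinuous on a complete CAT(0) space and $\mu>0$, for each $x\in X$ there is a unique point $J_\mu(x)\in X$ with $\mu F(J_\mu(x))+d(x,J_\mu(x))^2=\inf_{y\in X}\{\mu F(y)+d(x,y)^2\}$; the map $J_\mu:X\to X$ is the resolvent of $F$ of order $\mu$. A map $T:X\to X$ is firmly nonexpansive if $d(Tx,Ty)\le d((1-\lambda)x\oplus\lambda Tx,(1-\lambda)y\oplus\lambda Ty)$ for all $x,y\in X$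 and all $\lambda\in(0,1)$. *)

(* Defs.v *)
From mathcomp Require Import all_boot all_order all_algebra.
From mathcomp Require Import all_classical all_reals all_analysis.

Set Implicit Arguments.
Unset Strict Implicit.
Unset Printing Implicit Defensive.

Import Order.TTheory GRing.Theory Num.Theory.
Import numFieldNormedType.Exports.

Local Open Scope classical_set_scope.
Local Open Scope ring_scope.

(* This is the axiom of the library's completeType, whose instances must also
   come with a distinguished point; here the space may a priori be empty. *)
Definition complete_space (X : uniformType) : Prop :=
  forall G : set_system X, ProperFilter G -> cauchy G -> exists l : X, G --> l.

Section CAT0.
Context {R : realType} {X : metricType R}.

(* A map [a, b] -> X is represented by a function on R, of which only the
   values on [a, b] matter. *)
Definition geodesic (a b : R) (g : R -> X) : Prop :=
  a <= b /\
  {in `[a, b] &, forall s t, mdist (g s) (g t) = `|s - t|}.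

Definition geodesic_space : Prop :=
  forall x y : X, x <> y ->
    exists a b g, [/\ geodesic a b g, g a = x & g b = y].

Definition CAT0_space : Prop :=
  geodesic_space /\
  forall x y z m : X,
    mdist x m = 2^-1 * mdist x y -> mdist y m = 2^-1 * mdist x y ->
    mdist z m ^+ 2 <=
      2^-1 * mdist z x ^+ 2 + 2^-1 * mdist z y ^+ 2 - 4^-1 * mdist x y ^+ 2.

(* The point (1 - l) x (+) l y.  In a CAT(0) space, for l in [0, 1], the set
   below is a singleton; the default value x is then irrelevant. *)
Definition oplus (l : R) (x y : X) : X :=
  xget x [set z | mdist x z = l * mdist x y /\
                  mdist y z = (1 - l) * mdist x y].

(* F composed with every geodesic is convex.  The products and the sum in \bar R
   are the usual ones as long as F avoids -oo (with 0 * +oo = 0). *)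
Definition geod_convex (F : X -> \bar R) : Prop :=
  forall (a b : R) (g : R -> X), geodesic a b g ->
  {in `[a, b] &, forall s t, forall l : R, 0 <= l <= 1 ->
    (F (g ((1 - l) * s + l * t)%R) <=
       (1 - l)%:E * F (g s) + l%:E * F (g t))%E}.

Definition proper_fun (F : X -> \bar R) : Prop := exists x, (F x < +oo)%E.

Definition prox_objective (F : X -> \bar R) (mu : R) (x y : X) : \bar R :=
  (mu%:E * F y + (mdist x y ^+ 2)%:E)%E.

(* The resolvent J_mu.  For F proper, convex and lower semicontinuous on a
   complete CAT(0) space and mu > 0, the set below is a singleton; the default
   value x is then irrelevant. *)
Definition resolvent (F : X -> \bar R) (mu : R) (x : X) : X :=
  xget x [set z | prox_objective F mu x z =
                  ereal_inf (range (prox_objective F mu x))].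

Definition firmly_nonexpansive (T : X -> X) : Prop :=
  forall (x y : X) (l : R), 0 < l < 1 ->
    mdist (T x) (T y) <= mdist (oplus l x (T x)) (oplus l y (T y)).

End CAT0.

Arguments geodesic_space {R} X.
Arguments CAT0_space {R} X.

(* Main.v *)
Require Import Defs.
From mathcomp Require Import all_boot all_order all_algebra.
From mathcomp Require Import all_classical all_reals all_analysis.
From mathcomp Require Import ring lra.

Set Implicit Arguments.
Unset Strict Implicit.
Unset Printing Implicit Defensive.

Import Order.TTheory GRing.Theory Num.Theory.
Import numFieldNormedType.Exports.

Local Open Scope classical_set_scope.
Local Open Scope ring_scope.

(** The convexity of F and the CAT(0) inequality at midpoints make
    z |-> mu F(z) + d(x,z)^2 strongly convex.  Hence minimizing sequences are
    Cauchy (the infimum is finite because a convex lower semicontinuous F is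
    bounded below by a multiple of the distance), and p = J_mu(x) satisfies
    mu F(p) + d(x,p)^2 + d(p,z)^2 <= mu F(z) + d(x,z)^2 for all z.
    Adding the cases z = q and z = p of this inequality for x, p and for
    y, q = J_mu(y) gives
    d(x,p)^2 + d(y,q)^2 + 2 d(p,q)^2 <= d(x,q)^2 + d(y,p)^2,
    and the quadrilateral inequality bounds the right-hand side by
    d(x,p)^2 + d(y,q)^2 + d(x,y)^2 + d(p,q)^2, so that d(p,q) <= d(x,y).
    Firm nonexpansiveness follows because p is also the point
    J_((1-l) mu)((1-l) x (+) l p). *)

Section Prox.
Context {R : realType} {X : metricType R}.
Implicit Types (F : X -> \bar R) (x y z p q m : X) (r s t l mu : R).

(** * Points on geodesics and the quadrilateral inequality *)

Lemma ereal_le_fin (e : \bar R) r :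
  e != -oo%E -> (e <= r%:E)%E -> exists2 s, e = s%:E & s <= r.
Proof. by case: e => [s| |] //; rewrite lee_fin => _ sr; exists s. Qed.

(** The point is read off a geodesic that is then forgotten, so the convexity bound at that same
    point is exported along with its distances. *)
Lemma geodesic_point x y t : geodesic_space X -> 0 <= t <= 1 ->
  exists z, [/\ mdist x z = t * mdist x y, mdist y z = (1 - t) * mdist x y &
    forall F r s, (forall w, F w != -oo%E) -> geod_convex F ->
      F x = r%:E -> F y = s%:E ->
      exists2 u, F z = u%:E & u <= (1 - t) * r + t * s].
Proof.
(* [geodesic_space] joins only distinct points, so [x = y] is treated apart. *)
move=> Xg /andP[t0 t1]; have [<-|xy] := pselect (x = y).
  exists x; rewrite !mdistxx !mulr0; split=> // F r s _ _ -> [<-].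
  by exists r => //; lra.
have [a [b [g [[ab gd] ga gb]]]] := Xg x y xy.
have aI : a \in `[a, b] by rewrite in_itv /= lexx ab.
have bI : b \in `[a, b] by rewrite in_itv /= lexx ab.
have dxy : mdist x y = b - a.
  by rewrite -ga -gb gd// distrC ger0_norm // subr_ge0.
set c := (1 - t) * a + t * b.
have ac : c - a = t * (b - a) by rewrite /c; ring.
have cb : b - c = (1 - t) * (b - a) by rewrite /c; ring.
have ac0 : 0 <= c - a by rewrite ac mulr_ge0 ?subr_ge0.
have cb0 : 0 <= b - c by rewrite cb mulr_ge0 ?subr_ge0.
have cI : c \in `[a, b] by rewrite in_itv /=; lra.
exists (g c); split.
- by rewrite -{1}ga gd// distrC ger0_norm// dxy.
- by rewrite -{1}gb gd// ger0_norm// dxy.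
- move=> F r s Fno Fc Fx Fy; apply: ereal_le_fin => //.
  rewrite EFinD !EFinM -Fx -Fy -ga -gb.
  by apply: (Fc a b g) => //; rewrite t0.
Qed.

Lemma midpoint x y : geodesic_space X ->
  exists m, [/\ mdist x m = 2^-1 * mdist x y, mdist y m = 2^-1 * mdist x y &
    forall F r s, (forall w, F w != -oo%E) -> geod_convex F ->
      F x = r%:E -> F y = s%:E ->
      exists2 u, F m = u%:E & u <= 2^-1 * r + 2^-1 * s].
Proof.
move=> Xg; have h : 0 <= (2^-1 : R) <= 1 by lra.
have [m [xm ym Fm]] := geodesic_point x y Xg h.
have e : 1 - 2^-1 = 2^-1 :> R by field.
by exists m; move: xm ym Fm; rewrite e.
Qed.

(** Let m be the midpoint of x and q. Add the CAT(0) inequalities at m seen from y and from p, then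
    use d(y,p)^2 <= (d(y,m) + d(p,m))^2 <= 2 d(y,m)^2 + 2 d(p,m)^2. *)
Lemma CAT0_quadrilateral x y q p : CAT0_space X ->
  mdist x q ^+ 2 + mdist y p ^+ 2 <=
  mdist x y ^+ 2 + mdist y q ^+ 2 + mdist q p ^+ 2 + mdist p x ^+ 2.
Proof.
move=> [Xg Xc]; have [m [xm qm _]] := midpoint x q Xg.
have := Xc x q y m xm qm; have := Xc x q p m xm qm.
have := metric_triangle y m p; rewrite (metric_sym m p).
rewrite (metric_sym y x) (metric_sym p q).
have := mdist_ge0 y p; have := mdist_ge0 y m; have := mdist_ge0 p m.
set a := mdist p m; set b := mdist y m; set c := mdist y p.
move=> a0 b0 c0 cab ha hb.
have : c ^+ 2 <= (b + a) ^+ 2 by rewrite ler_sqr ?nnegrE ?addr_ge0.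
have : 0 <= (b - a) ^+ 2 by exact: sqr_ge0.
nra.
Qed.

(** * Minimizers: variational inequality, nonexpansiveness, change of base point *)

(** Only finite values of [F] are compared, which keeps the inequality in the reals; for [mu] > 0,
    points where [F] is +oo cannot compete. *)
Definition prox_min F mu x p r :=
  F p = r%:E /\ forall z s, F z = s%:E ->
    mu * r + mdist x p ^+ 2 <= mu * s + mdist x z ^+ 2.

Section ProxConvex.
Context (F : X -> \bar R) (XC : CAT0_space X).
Context (Fno : forall x, F x != -oo%E) (Fcvx : geod_convex F).

Lemma midpoint_objective mu x y z r s : 0 < mu -> F y = r%:E -> F z = s%:E ->
  exists m u, [/\ mdist y m = 2^-1 * mdist y z, F m = u%:E &
    mu * u + mdist x m ^+ 2 <= 2^-1 * (mu * r + mdist x y ^+ 2) +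
      2^-1 * (mu * s + mdist x z ^+ 2) - 4^-1 * mdist y z ^+ 2].
Proof.
move=> mu0 Fy Fz; have [Xg Xc] := XC; have [m [ym zm Fm]] := midpoint y z Xg.
have [u Fmu ule] := Fm F r s Fno Fcvx Fy Fz.
exists m, u; split=> //.
have := Xc y z x m ym zm; have := ler_wpM2l (ltW mu0) ule.
lra.
Qed.

(* Halving towards p turns the bound with constant c into the one with
   constant (1 + c) / 2. *)
Lemma prox_min_variational mu x p r z s : 0 < mu ->
  prox_min F mu x p r -> F z = s%:E ->
  mu * r + mdist x p ^+ 2 + mdist p z ^+ 2 <= mu * s + mdist x z ^+ 2.
Proof.
move=> mu0 [Fp pmin] Fz.
have bound k : forall z s, F z = s%:E ->
    mu * r + mdist x p ^+ 2 + (1 - 2^-1 ^+ k) * mdist p z ^+ 2 <=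
    mu * s + mdist x z ^+ 2.
  elim: k => [|k IH] {}z {}s {}Fz.
    by rewrite expr0 subrr mul0r addr0; exact: pmin.
  have [m [u [pm Fm mle]]] := midpoint_objective x mu0 Fp Fz.
  have := IH _ _ Fm; rewrite pm exprMn [2^-1 ^+ k.+1]exprS.
  move: (2^-1 ^+ k) mle => w mle H.
  have -> : (1 - 2^-1 * w) * mdist p z ^+ 2 =
    2 * ((1 - w) * (2^-1 ^+ 2 * mdist p z ^+ 2)) + 2^-1 * mdist p z ^+ 2
    by field.
  lra.
set D := mdist p z ^+ 2.
(* Letting k tend to infinity turns the constants 1 - 2^-k into 1. *)
suff cv : (fun k => mu * r + mdist x p ^+ 2 + (1 - 2^-1 ^+ k) * D) @ \oo
    --> mu * r + mdist x p ^+ 2 + (1 - 0) * D.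
  move: cv; rewrite subr0 mul1r => cv.
  rewrite -(cvg_lim _ cv)//; apply: limr_le.
    by apply/cvg_ex; eexists; exact: cv.
  by apply: nearW => k; exact: bound.
apply: cvgD; first exact: cvg_cst.
apply: cvgMl; apply: cvgB; first exact: cvg_cst.
apply: cvg_expr; rewrite ger0_norm; lra.
Qed.

Lemma prox_min_nonexpansive mu x y p q r s : 0 < mu ->
  prox_min F mu x p r -> prox_min F mu y q s -> mdist p q <= mdist x y.
Proof.
move=> mu0 xp yq.
have := prox_min_variational mu0 xp (proj1 yq).
have := prox_min_variational mu0 yq (proj1 xp).
have := CAT0_quadrilateral x y q p XC.
rewrite (metric_sym q p) (metric_sym p x) => h1 h2 h3.
rewrite -ler_sqr ?nnegrE ?mdist_ge0//; lra.
Qed.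

End ProxConvex.

(** Bound d(x,z) by the triangle inequality through [x'] and insert this in minimality at [x],
    scaled by 1 - [l]: the slack left in the goal is [l] times a perfect square. *)
Lemma prox_min_segment F mu x p r l x' : 0 < l < 1 ->
  prox_min F mu x p r -> mdist x x' = l * mdist x p ->
  mdist p x' = (1 - l) * mdist x p ->
  prox_min F ((1 - l) * mu) x' p r.
Proof.
move=> /andP[l0 l1] [Fp pmin] xx' px'; split=> // z s /pmin.
have := metric_triangle x x' z.
rewrite (metric_sym x' p) xx' px'.
have := mdist_ge0 x z; have := mdist_ge0 x p; have := mdist_ge0 x' z.
move: (mdist x p) (mdist x' z) (mdist x z) => a w d w0 a0 d0 dle min.
have : d ^+ 2 <= (l * a + w) ^+ 2.
  by rewrite ler_sqr ?nnegrE ?addr_ge0 ?mulr_ge0// ltW.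
have : 0 <= l * ((1 - l) * a - w) ^+ 2 by rewrite mulr_ge0 ?sqr_ge0 ?ltW.
have l10 : 0 < 1 - l by lra.
move=> h1 h2.
have h3 : (1 - l) * (mu * r + a ^+ 2) <= (1 - l) * (mu * s + (l * a + w) ^+ 2).
  by rewrite ler_pM2l//; lra.
nra.
Qed.

(** * Existence of the minimizer *)

(** Lower semicontinuity bounds [F] below on a ball around [x0]; convexity along geodesics from [x0]
    extends this to a bound linear in the distance, which the quadratic term absorbs. *)
Lemma objective_bounded_below F mu x : 0 < mu -> geodesic_space X ->
  (forall y, F y != -oo%E) ->
  proper_fun F -> geod_convex F -> lower_semicontinuous F ->
  exists c, forall y s, F y = s%:E -> c <= mu * s + mdist x y ^+ 2.
Proof.
move=> mu0 Xg Fno [x0 Fx0] Fcvx Flsc.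
have [r0 Fr0] : exists r0, F x0 = r0%:E.
  by move: Fx0 (Fno x0); case: (F x0) => // r _ _; exists r.
have [V /nbhs_ballP[d /= d0 dV] VF] : exists2 V, nbhs x0 V &
    forall y, V y -> ((r0 - 1)%:E < F y)%E.
  by apply: Flsc; rewrite Fr0 lte_fin; lra.
have near_x0 y s : mdist x0 y < d -> F y = s%:E -> r0 - 1 < s.
  move=> yd Fy; rewrite -lte_fin -Fy; apply/VF/dV.
  by rewrite ballEmdist.
set K := 2 / d; have K0 : 0 < K by rewrite divr_gt0.
have linear y s : F y = s%:E -> r0 - 1 - K * mdist x0 y <= s.
  move=> Fy; have [yd|dy] := ltP (mdist x0 y) d.
    have := near_x0 _ _ yd Fy; have : 0 <= K * mdist x0 y.
      by rewrite mulr_ge0 ?mdist_ge0 ?ltW.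
    lra.
  have D0 : 0 < mdist x0 y by lra.
  (* This places [z] at distance [d / 2] from [x0], inside the ball; [K] is the slope for which 1 /
     [t] = [K * mdist x0 y]. *)
  set t := d / (2 * mdist x0 y).
  have t0 : 0 < t by rewrite divr_gt0 ?mulr_gt0.
  have t1 : 0 <= t <= 1.
    by rewrite (ltW t0)/= ler_pdivrMr ?mulr_gt0// mul1r; lra.
  have [z [x0z _ Fz]] := geodesic_point x0 y Xg t1.
  have [u Fzu ule] := Fz F r0 s Fno Fcvx Fr0 Fy.
  have zd : mdist x0 z < d.
    have -> : mdist x0 z = d / 2 by rewrite x0z /t; field; rewrite gt_eqF.
    lra.
  have := near_x0 _ _ zd Fzu => u_gt.
  have tK : t * (K * mdist x0 y) = 1.
    by rewrite /t /K; field; rewrite !gt_eqF.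
  rewrite -(ler_pM2l t0) mulrBr tK.
  nra.
(* Completing the square in w^2 - mu K w, with w = d(x,y), costs at most (mu K)^2 / 4, rounded up
   here to (mu K)^2. *)
exists (mu * (r0 - 1) - mu * K * mdist x0 x - (mu * K) ^+ 2) => y s /linear.
have := metric_triangle x0 x y.
move: (mdist x0 x) (mdist x y) (mdist x0 y) => a w b bale sle.
have muK0 : 0 < mu * K by rewrite mulr_gt0.
have h1 : mu * (r0 - 1 - K * b) <= mu * s by rewrite ler_pM2l.
have h2 : mu * K * b <= mu * K * (a + w) by rewrite ler_pM2l.
have : 0 <= (w - mu * K / 2) ^+ 2 by exact: sqr_ge0.
have := sqr_ge0 (mu * K).
nra.
Qed.

(** The sets [S e] of near-minimizers generate a Cauchy filter, so no sequence need be chosen; lower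
    semicontinuity makes its limit a minimizer. *)
Lemma prox_min_exists F mu x : 0 < mu -> complete_space X -> CAT0_space X ->
  (forall y, F y != -oo%E) ->
  proper_fun F -> geod_convex F -> lower_semicontinuous F ->
  exists p r, prox_min F mu x p r.
Proof.
move=> mu0 Xcomp XC Fno Fprop Fcvx Flsc.
pose G y s := mu * s + mdist x y ^+ 2.
pose V := [set v | exists y s, F y = s%:E /\ v = G y s].
have [c cle] := objective_bounded_below x mu0 (proj1 XC) Fno Fprop Fcvx Flsc.
have Vinf : has_inf V.
  split; last by exists c => _ [y [s [Fy ->]]]; exact: cle.
  have [x0 Fx0] := Fprop.
  move: Fx0 (Fno x0); case E : (F x0) => [s| |] // _ _.
  by exists (G x0 s), x0, s.
have infle y s : F y = s%:E -> inf V <= G y s.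
  by move=> Fy; apply: ge_inf; [case: Vinf|exists y, s].
pose S e := [set y | exists2 s, F y = s%:E & G y s < inf V + e].
have S_nonempty e : 0 < e -> S e !=set0.
  move=> e0; have [_ [y [s [Fy ->]]] lt] := inf_adherent e0 Vinf.
  by exists y, s.
(* The midpoint of [y] and [z] cannot go below the infimum, so the gain d(y,z)^2 / 4 is less than
   [e]. *)
have S_diam e y z : S e y -> S e z -> mdist y z ^+ 2 < 4 * e.
  move=> [r Fy yr] [s Fz zs].
  have [m [u [_ Fm mle]]] := midpoint_objective XC Fno Fcvx x mu0 Fy Fz.
  by have := infle _ _ Fm; move: mle yr zs; rewrite /G; lra.
pose A := filter_from [set e : R | 0 < e] S.
have A_filter : ProperFilter A.
  apply: filter_from_proper; last by move=> e; exact: S_nonempty.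
  apply: filter_from_filter; first by exists 1 => /=.
  move=> e e' /= e0 e'0; exists (Num.min e e'); first by rewrite /= lt_min e0.
  move=> y [s Fy]; rewrite addrC -ltrBlDr lt_min => /andP[h h'].
  by split; exists s => //; lra.
have A_cauchy : cauchy A.
  move=> E; rewrite -entourage_ballE => -[e /= e0 eE].
  have e40 : 0 < e ^+ 2 / 4 by rewrite divr_gt0 ?exprn_gt0.
  exists (S (e ^+ 2 / 4), S (e ^+ 2 / 4)).
    by split; exists (e ^+ 2 / 4).
  move=> [y z] [/= Sy Sz]; apply: eE; rewrite /= ballEmdist /=.
  rewrite -ltr_sqr ?nnegrE ?mdist_ge0 ?ltW//.
  by have := S_diam _ _ _ Sy Sz; lra.
have [p Ap] := Xcomp A A_filter A_cauchy.
set D := mdist x p.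
(* Otherwise [F] exceeds some [a] near [p] with [mu * a + D ^+ 2] above the infimum by [eta] > 0,
   which contradicts the presence of [eta / 2]-minimizers arbitrarily near [p]. *)
have Fp : (F p <= ((inf V - D ^+ 2) / mu)%:E)%E.
  rewrite leNgt; apply/negP => lt.
  have [a lta aF] : exists2 a, (inf V - D ^+ 2) / mu < a & (a%:E < F p)%E.
    case: (F p) lt => [b| |] //; last first.
      by move=> _; exists ((inf V - D ^+ 2) / mu + 1); rewrite ?ltry//; lra.
    rewrite lte_fin => lt; exists (((inf V - D ^+ 2) / mu + b) / 2); first by lra.
    by rewrite lte_fin; lra.
  have [U pU UF] := Flsc p a aF.
  pose eta := mu * a + D ^+ 2 - inf V.
  have eta0 : 0 < eta.
    by move: lta; rewrite ltr_pdivrMr// /eta [mu * a]mulrC; lra.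
  have D0 : 0 <= D by exact: mdist_ge0.
  (* Moving by less than [d] lowers the squared distance to [x] by at most [2 * d * D], hence by at
     most [eta / 2]; the [+ 1] covers [D] = 0. *)
  pose d := eta / (4 * (D + 1)).
  have d0 : 0 < d by rewrite divr_gt0// mulr_gt0//; lra.
  have dD : 2 * d * D <= eta / 2.
    have : eta = d * (4 * (D + 1)) by rewrite /d; field; lra.
    by move=> ->; nra.
  have /Ap AU : nbhs p (U `&` ball p d).
    by apply: filterI => //; exact: nbhsx_ballx.
  have eta20 : 0 < eta / 2 by lra.
  have AS : A (S (eta / 2)) by exists (eta / 2).
  have [y [[Uy]]] := filter_ex (filterI AU AS).
  rewrite ballEmdist /= => py [s Fy ys].
  have := UF y Uy; rewrite Fy lte_fin -(ltr_pM2l mu0) => as_.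
  have := metric_triangle x y p; rewrite (metric_sym y p) -/D.
  have := mdist_ge0 x y; move: ys; rewrite /G.
  move: (mdist x y) => w ys w0 Dw.
  have : 0 <= (w - D) ^+ 2 by exact: sqr_ge0.
  have : D - d <= w by lra.
  move=> /(ler_wpM2l D0).
  rewrite /eta in dD ys *; lra.
have [r Fr rle] := ereal_le_fin (Fno p) Fp.
exists p, r; split=> // z s Fz; apply: le_trans (infle z s Fz).
by move: rle; rewrite ler_pdivlMr// [r * mu]mulrC -/D; lra.
Qed.

(** * From minimizers to the resolvent *)

(** The existing minimizer rules out the default value of [xget] and makes the infimum finite, so a
    point attaining it has a finite value of [F]. *)
Lemma resolvent_prox_min F mu x : 0 < mu -> complete_space X -> CAT0_space X ->
  (forall y, F y != -oo%E) ->
  proper_fun F -> geod_convex F -> lower_semicontinuous F ->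
  exists r, prox_min F mu x (resolvent F mu x) r.
Proof.
move=> mu0 Xcomp XC Fno Fprop Fcvx Flsc.
have [p [r [Fp pmin]]] := prox_min_exists x mu0 Xcomp XC Fno Fprop Fcvx Flsc.
have infE : ereal_inf (range (prox_objective F mu x)) =
    (mu * r + mdist x p ^+ 2)%:E.
  apply/eqP; rewrite eq_le; apply/andP; split.
    by apply: ereal_inf_lbound; exists p => //; rewrite /prox_objective Fp.
  apply: le_ereal_inf_tmp => _ [z _ <-]; rewrite /prox_objective.
  case E : (F z) (Fno z) => [s| |] // _.
    by rewrite -EFinM -EFinD lee_fin; exact: pmin.
  by rewrite gt0_muley ?lte_fin// addye// leey.
rewrite /resolvent; case: xgetP => [z _ /= |/(_ p)]; last first.
  by rewrite /= infE /prox_objective Fp.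
rewrite infE /prox_objective; case E : (F z) (Fno z) => [s| |] // _; last first.
  by rewrite gt0_muley ?lte_fin// addye.
by rewrite -EFinM -EFinD => -[zE]; exists s; split=> // w u; rewrite zE; exact: pmin.
Qed.

Lemma oplus_dist l x y : geodesic_space X -> 0 <= l <= 1 ->
  mdist x (oplus l x y) = l * mdist x y /\
  mdist y (oplus l x y) = (1 - l) * mdist x y.
Proof.
move=> Xg l01; rewrite /oplus; case: xgetP => [z _ //|].
by have [z [xz yz _]] := geodesic_point x y Xg l01 => /(_ z); case.
Qed.

End Prox.

Theorem proposition3p3 (R : realType) (X : metricType R) (F : X -> \bar R) :
  complete_space X -> CAT0_space X ->
  (forall x, F x != -oo%E) ->
  proper_fun F -> geod_convex F -> lower_semicontinuous F ->
  forall mu : R, 0 < mu -> firmly_nonexpansive (resolvent F mu).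
Proof.
move=> Xcomp XC Fno Fprop Fcvx Flsc mu mu0 x y l l01.
have [r xr] := resolvent_prox_min x mu0 Xcomp XC Fno Fprop Fcvx Flsc.
have [s ys] := resolvent_prox_min y mu0 Xcomp XC Fno Fprop Fcvx Flsc.
have l01w : 0 <= l <= 1 by lra.
have [xx' px'] := oplus_dist x (resolvent F mu x) (proj1 XC) l01w.
have [yy' qy'] := oplus_dist y (resolvent F mu y) (proj1 XC) l01w.
(* Both resolvent points are now viewed as minimizers of order [(1 - l) * mu] based at the
   interpolated points, where nonexpansiveness is the goal. *)
have lmu0 : 0 < (1 - l) * mu by rewrite mulr_gt0//; lra.
apply: (prox_min_nonexpansive XC Fno Fcvx lmu0).
- exact: prox_min_segment l01 xr xx' px'.
- exact: prox_min_segment l01 ys yy' qy'.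
Qed.
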